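(* Let $p$ be a prime and $G$ a $p$-group of maximal class of order $p^m$ ($m\ge4$) with positive degree of commutativity. (1) If $G$ possesses an abelian maximal subgroup, then $$B_G(t)=\frac{1}{1-pt}\left(1+\frac{(p^{m-2}-1)t}{1-p^{m-1}t}+\frac{(p^2-p)t}{1-p^2t}\right).$$ (2) If $[P_1,P_3]=1$ and $G$ possesses no abelian maximal subgroup, then $$B_G(t)=\frac{1}{1-pt}\left(1+\frac{(p^{m-4}-1)t(1-p^{m-4}t)}{(1-p^{m-2}t)(1-p^{m-3}t)}+\frac{(p^{m-3}-p^{m-5})t}{1-p^{m-2}t}+\frac{(p^2-p)t}{1-p^2t}\right).$$
   Context: For a finite group $G$ and $n\ge0$, let $G^{(n)}\subseteq G^n$ be the set of $n$-tuples of pairwise commuting elements, on which $G$ acts by simultaneous conjugation; let $\beta_{G,n}$ be the number of orbits and $B_G(t)=\sum_{n\ge0}\beta_{G,n}t^n$. A group of order $p^m$ with $m\ge4$ is of maximal class if it has nilpotency class $m-1$. Let $\gamma_i(G)$ be the lower central series. Define $P_0=G$, $P_1$ to be the centralizer in $G$ of $\gamma_2(G)/\gamma_4(G)$ (i.e. $\{g\in G:[g,\gamma_2(G)]\le\gamma_4(G)\}$), and $P_i=\gamma_i(G)$ for $2\le i\le m$. The degree of commutativity $l$ of $G$ is the maximum integer such that $[P_i,P_j]\le P_{i+j+l}$ for all $i,j\ge1$ if $P_1$ is not abelian (with $P_k=1$ for $k\ge m$), and $l=m-3$ if $P_1$ is abelian. Positive degree of commutativity means $l>0$. *)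

(* Defs.v *)
From mathcomp Require Import all_boot all_order all_algebra all_fingroup all_solvable.
Set Implicit Arguments. Unset Strict Implicit. Unset Printing Implicit Defensive.
Import GRing.Theory Num.Theory.

Local Open Scope group_scope.

Section CommTuples.
Variable gT : finGroupType.
Implicit Types G : {group gT}.

Definition commuting_tuples G (n : nat) : {set {ffun 'I_n -> gT}} :=
  [set f : {ffun 'I_n -> gT} |
     [forall i, f i \in G] && [forall i, forall j, f i * f j == f j * f i]].

Definition tconj (n : nat) (f : {ffun 'I_n -> gT}) (g : gT) : {ffun 'I_n -> gT} :=
  [ffun i => f i ^ g].

Definition beta G (n : nat) : nat :=
  #|[set [set tconj f g | g in G] | f in commuting_tuples G n]|.

Definition Pser G (m i : nat) : {set gT} :=
  if i == 0%N then (G : {set gT})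
  else if i == 1%N then
    [set g in G | [forall h in 'L_2(G), [~ g, h] \in 'L_4(G)]]
  else if (i < m)%N then 'L_i(G) else [1 gT].

Definition maximal_class (p : nat) G (m : nat) : Prop :=
  [/\ prime p, #|G| = (p ^ m)%N, (4 <= m)%N & nil_class G = m.-1].

(* positive degree of commutativity: either P_1 is abelian (then l = m-3 > 0),
   or the maximal l with [P_i,P_j] <= P_{i+j+l} for all i,j >= 1 is >= 1,
   i.e. (the condition being monotone in l) l = 1 satisfies it. *)
Definition pos_deg_comm G (m : nat) : Prop :=
  abelian (Pser G m 1) \/
  (forall i j : nat, (0 < i)%N -> (0 < j)%N ->
     [~: Pser G m i, Pser G m j] \subset Pser G m (i + j + 1)).

Definition has_abelian_maximal G : Prop :=
  exists M : {group gT}, maximal M G /\ abelian M.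

End CommTuples.

Local Open Scope ring_scope.
Definition series := nat -> rat.
Definition sconst (c : rat) : series := fun n => if n == 0%N then c else 0.
Definition sX : series := fun n => if n == 1%N then 1 else 0.
Definition sadd (f g : series) : series := fun n => f n + g n.
Definition sscale (c : rat) (f : series) : series := fun n => c * f n.
Definition smul (f g : series) : series :=
  fun n => \sum_(i < n.+1) f i * g (n - i)%N.
(* the power series expansion of 1/(1 - a t) *)
Definition sinv_lin (a : rat) : series := fun n => a ^+ n.
Definition slin (a : rat) : series := sadd (sconst 1) (sscale (- a) sX).

Definition Bser (gT : finGroupType) (G : {group gT}) : series :=
  fun n => ((beta G n)%:R : rat).

(* Main.v *)
(* Let c_n(H) be the number of commuting n-tuples of H. By Burnside's lemma
   beta_n(G) |G| = c_{n+1}(G), and c_{n+1}(G) is the sum of the c_n(C_G(a)) over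
   a in G. In both cases G has a maximal subgroup M (the abelian one, or P_1) such
   that C_M(x) = Z(G) has order p for all x outside M, so that C_G(x) is abelian
   of order p^2; the recursion gives c_n(G) = c_n(M) + p^(m-2) (p^(2n) - p^n).
   In case (1), c_n(M) = p^((m-1)n). In case (2), P_3 is central of index p^2 in
   the nonabelian group M, the centralizers in M of elements outside P_3 are
   abelian of order p^(m-2), and c_n(M) = (p+1) p^((m-2)n) - p p^((m-3)n). *)
Require Import Defs.
From mathcomp Require Import all_boot all_order all_algebra all_fingroup all_solvable.
From Stdlib Require Import FunctionalExtensionality.
From mathcomp Require Import zify ring.
Set Implicit Arguments. Unset Strict Implicit. Unset Printing Implicit Defensive.
Import GRing.Theory Num.Theory.

(** * Counting commuting tuples by centralizers *)

Section CommutingTuples.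
Local Open Scope group_scope.
Variable gT : finGroupType.
Implicit Types G M : {group gT}.

Lemma commuting_tuplesP G n (f : {ffun 'I_n -> gT}) :
  reflect ((forall i, f i \in G) /\ (forall i j, commute (f i) (f j)))
          (f \in commuting_tuples G n).
Proof.
rewrite inE; apply: (iffP andP) => [[/forallP fG /forallP fC]|[fG fC]].
  by split=> // i j; have /forallP/(_ j)/eqP := fC i.
by split; apply/forallP=> // i; apply/forallP=> j; apply/eqP/fC.
Qed.

Lemma card_commuting_tuples0 G : #|commuting_tuples G 0| = 1%N.
Proof.
rewrite (_ : commuting_tuples G 0 = setT).
  by rewrite cardsT card_ffun card_ord expn0.
by apply/setP=> f; rewrite [RHS]inE; apply/commuting_tuplesP; split=> [[]|[]].
Qed.

Lemma card_commuting_tuples_abelian G n :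
  abelian G -> #|commuting_tuples G n| = (#|G| ^ n)%N.
Proof.
move=> /centsP cGG; rewrite -[n in RHS]card_ord -card_ffun_on.
apply: eq_card => f; apply/commuting_tuplesP/ffun_onP => [[]//|fG].
by split=> // i j; apply: cGG.
Qed.

(** Fixing the first entry [a] leaves an arbitrary commuting [n]-tuple of its centralizer; [cns]
    puts [a] back in front. *)
Lemma card_commuting_tuplesS G n :
  #|commuting_tuples G n.+1|
    = (\sum_(a in G) #|commuting_tuples 'C_G[a] n|)%N.
Proof.
rewrite -sum1_card
  (partition_big (fun f : {ffun 'I_n.+1 -> gT} => f ord0) (mem G)) /=; last first.
  by move=> f /commuting_tuplesP[fG _]; apply: fG.
apply: eq_bigr => a aG; rewrite sum1_card.
pose cns (f : {ffun 'I_n -> gT}) :=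
  [ffun i => if unlift ord0 i is Some j then f j else a] : {ffun 'I_n.+1 -> gT}.
have cns0 f : cns f ord0 = a by rewrite ffunE unlift_none.
have cnsS f j : cns f (lift ord0 j) = f j by rewrite ffunE liftK.
have cnsI : injective cns.
  by move=> f g eqfg; apply/ffunP=> j; rewrite -!cnsS eqfg.
rewrite -(card_imset _ cnsI); apply: eq_card => f; rewrite unfold_in.
apply/andP/imsetP => [[/commuting_tuplesP[fG fC] /eqP f0]|[g /commuting_tuplesP[gC gg] ->]].
  exists [ffun j => f (lift ord0 j)].
    apply/commuting_tuplesP; split=> [i|i j]; rewrite !ffunE; last exact: fC.
    by rewrite inE fG -f0; apply/cent1P/fC.
  apply/ffunP=> i; rewrite ffunE; case: unliftP => [j|] -> //.
  by rewrite ffunE.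
rewrite cns0; split=> //; apply/commuting_tuplesP.
have gG i : g i \in G by have /setIP[] := gC i.
have ga i : commute a (g i) by have /setIP[_ /cent1P] := gC i.
split=> [i|i j]; rewrite !ffunE.
  by case: unliftP => [k|] _.
case: unliftP => [k|] _; case: unliftP => [l|] _ //; first exact/commute_sym/ga.
Qed.

Lemma tconj_is_action n : is_action [set: gT] (@tconj gT n).
Proof.
apply: is_total_action => [f|f x y]; apply/ffunP=> i; rewrite !ffunE ?conjg1 //.
exact: conjgM.
Qed.

Canonical tconj_action n := Action (tconj_is_action n).

(** Orbit counting: the [n]-tuples fixed by [a] are the commuting tuples of ['C_G[a]], and their
    numbers add up over [a] to the number of commuting [n.+1]-tuples. *)
Lemma card_commuting_tuples_beta G n :
  #|commuting_tuples G n.+1| = (beta G n * #|G|)%N.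
Proof.
have actsG : [acts G, on commuting_tuples G n | tconj_action n].
  apply/subsetP=> a aG; rewrite !inE /=; apply/subsetP=> f.
  move=> /commuting_tuplesP[fG fC]; rewrite inE; apply/commuting_tuplesP.
  split=> [i|i j]; rewrite !ffunE; first by rewrite groupJ.
  by rewrite /commute -!conjMg fC.
rewrite -(Frobenius_Cauchy actsG) card_commuting_tuplesS.
apply: eq_bigr => a aG; apply: eq_card => f; rewrite [RHS]inE.
apply/commuting_tuplesP/andP => [[fC ff]|[/commuting_tuplesP[fG fC]]].
  split; first by apply/commuting_tuplesP; split=> // i; have /setIP[] := fC i.
  rewrite inE sub1set inE; apply/eqP/ffunP=> i; rewrite ffunE.
  by have /setIP[_ /cent1P/commute_sym cfa] := fC i; apply/conjg_fixP/commgP.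
rewrite inE sub1set inE => /eqP/ffunP fa; split=> // i; rewrite inE fG /=.
by apply/cent1P/commgP/conjg_fixP; have := fa i; rewrite ffunE.
Qed.


Lemma card_commuting_tuples_center_out M (Z : {group gT}) k n :
  Z \subset 'Z(M) ->
  (forall a, a \in M :\: Z -> abelian 'C_M[a] /\ #|'C_M[a]| = k) ->
  #|commuting_tuples M n.+1|
   = (#|Z| * #|commuting_tuples M n| + (#|M| - #|Z|) * k ^ n)%N.
Proof.
move=> sZ abC; have sZM : Z \subset M by apply: subset_trans sZ (center_sub M).
rewrite card_commuting_tuplesS (big_setID Z) /= (setIidPr sZM); congr addn.
  rewrite -sum_nat_const; apply: eq_bigr => a /(subsetP sZ)/setIP[aM aC].
  congr #|commuting_tuples _ n|; apply/val_inj/setIidPl.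
  by rewrite sub_cent1.
rewrite -[(#|M| - _)%N](_ : #|M :\: Z| = _); last by rewrite cardsD (setIidPr sZM).
rewrite -sum_nat_const; apply: eq_bigr => a /abC[cC <-].
exact: card_commuting_tuples_abelian.
Qed.

(** The first entry is taken in ['Z(G)], in [M] outside ['Z(G)], or outside [M]. The middle terms
    are the same for [G] and for [M]; the central terms give the two products by [p], moved across
    so that only additions remain. *)
Lemma card_commuting_tuples_maximal G M p n :
  prime p -> p.-group G -> maximal M G -> #|'Z(G)| = p ->
  (forall x, x \in G :\: M -> 'C_M[x] = 'Z(G)) ->
  (#|commuting_tuples G n.+1| + p * #|commuting_tuples M n|
   = p * #|commuting_tuples G n| + #|commuting_tuples M n.+1|
     + (#|G| - #|M|) * p ^ (2 * n))%N.
Proof.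
move=> p_pr pG maxM oZ regM.
have /properP[sMG [x xG xM]] := maxgroupp maxM.
have xGM : x \in G :\: M by rewrite inE xM.
have sZM : 'Z(G) \subset M by rewrite -(regM x xGM) subsetIl.
have sZZM : 'Z(G) \subset 'Z(M).
  rewrite subsetI sZM; apply: subset_trans (subsetIr G _) (centS sMG).
have abC a : a \in G :\: M -> abelian 'C_G[a] /\ #|'C_G[a]| = (p ^ 2)%N.
  move=> aGM; have /setDP[aG aM] := aGM.
  suff oC : #|'C_G[a]| = (p ^ 2)%N.
    split=> //; apply: (p2group_abelian (pgroupS (subsetIl _ _) pG)).
    by rewrite oC pfactorK.
  (* As [a] lies outside the maximal normal subgroup [M], [G] is the product of [M] and ['C_G[a]].
     The product formula then makes ['C_G[a]] larger than ['C_M[a]], of order [p], by the factor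
     [p]. *)
  have iM := p_maximal_index pG maxM.
  have MC : (M * 'C_G[a])%g = G.
    apply: mulg_normal_maximal (p_maximal_normal pG maxM) maxM (subsetIl _ _) _.
    by apply: contra aM => /subsetP; apply; rewrite inE aG cent1id.
  have := mul_cardG M 'C_G[a]; rewrite MC setIA (setIidPl sMG) regM // oZ.
  rewrite -(Lagrange sMG) iM -mulnA => /eqP.
  by rewrite eqn_pmul2l ?cardG_gt0 // => /eqP ->.
have cntr a : a \in 'Z(G) -> 'C_G[a]%G = G /\ 'C_M[a]%G = M.
  case/setIP=> aG aC; split; apply/val_inj/setIidPl; rewrite sub_cent1 //.
  exact: subsetP (centS sMG) a aC.
have sumZ (H : {group gT}) : (forall a, a \in 'Z(G) -> 'C_H[a]%G = H) ->
    (\sum_(a in 'Z(G)) #|commuting_tuples 'C_H[a] n| = p * #|commuting_tuples H n|)%N.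
  by move=> CH; rewrite -oZ -sum_nat_const; apply: eq_bigr => a /CH ->.
rewrite !card_commuting_tuplesS [in LHS](big_setID M) /= (setIidPr sMG).
rewrite [in LHS](big_setID 'Z(G)) [in RHS](big_setID 'Z(G)) /= !(setIidPr sZM).
rewrite !sumZ; try by move=> a /cntr[].
have -> : (\sum_(a in M :\: 'Z(G)) #|commuting_tuples 'C_G[a] n|
    = \sum_(a in M :\: 'Z(G)) #|commuting_tuples 'C_M[a] n|)%N.
  apply: eq_bigr => a /setDP[aM aZ]; congr #|commuting_tuples _ n|.
  (* An element [y] outside [M] commuting with [a] would put [a] in ['C_M[y]], which is ['Z(G)]. *)
  apply/val_inj/eqP; rewrite eqEsubset (setSI _ sMG) andbT //=; apply/subsetP=> y.
  case/setIP=> yG /cent1P cay; rewrite inE; apply/andP; split; last exact/cent1P.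
  apply: contraR aZ => yM; rewrite -(regM y); last by rewrite inE yM.
  by rewrite inE aM; apply/cent1P/commute_sym.
have -> : (\sum_(a in G :\: M) #|commuting_tuples 'C_G[a] n|
           = (#|G| - #|M|) * p ^ (2 * n))%N.
  rewrite -[(#|G| - _)%N](_ : #|G :\: M| = _); last by rewrite cardsD (setIidPr sMG).
  rewrite -sum_nat_const; apply: eq_bigr => a /abC[cC oC].
  by rewrite card_commuting_tuples_abelian // oC expnM.
by rewrite [(p * #|commuting_tuples M n| + _)%N]addnC !addnA addnAC.
Qed.

(** By the preceding recursion the difference d_n of the two counts satisfies d_(n+1) = p d_n +
    (p^(m+2) - p^(m+1)) p^(2n) with d_0 = 0. Here the order of [G] is p^(m+2), so the solution is
    p^(m+2n) - p^(m+n). *)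
Lemma card_commuting_tuples_diff G M p m n :
  prime p -> #|G| = (p ^ m.+2)%N -> maximal M G -> #|'Z(G)| = p ->
  (forall x, x \in G :\: M -> 'C_M[x] = 'Z(G)) ->
  (#|commuting_tuples G n| + p ^ (m + n)
     = #|commuting_tuples M n| + p ^ (m + 2 * n))%N.
Proof.
move=> p_pr oG maxM oZ regM.
have pG : p.-group G by rewrite /pgroup oG pnatX pnat_id.
elim: n => [|n IHn]; first by rewrite !card_commuting_tuples0.
have := card_commuting_tuples_maximal n p_pr pG maxM oZ regM.
have := Lagrange (proper_sub (maxgroupp maxM)).
rewrite (p_maximal_index pG maxM) oG expnSr => /eqP.
rewrite eqn_pmul2r ?prime_gt0 // => /eqP ->.
have -> : ((p ^ m.+1 * p - p ^ m.+1) * p ^ (2 * n)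
           = p * (p * p ^ (m + 2 * n)) - p * p ^ (m + 2 * n))%N.
  by rewrite mulnBl !expnS expnD; congr subn; ring.
have -> : (p ^ (m + n.+1) = p * p ^ (m + n))%N by rewrite addnS expnS.
have -> : (p ^ (m + 2 * n.+1) = p * (p * p ^ (m + 2 * n)))%N.
  by rewrite mulnS addnCA !expnS.
have := congr1 (muln p) IHn; rewrite !mulnDr.
(* This bound lets [lia] treat the truncated subtraction as a true one. *)
have : (p * p ^ (m + 2 * n) <= p * (p * p ^ (m + 2 * n)))%N.
  by rewrite leq_pmul2l ?leq_pmull ?prime_gt0.
lia.
Qed.
End CommutingTuples.

(** * Commutators with an adjoined element, and central subgroups of index p^2 *)

Section GroupFacts.
Local Open Scope group_scope.
Variable gT : finGroupType.
Implicit Types G M H N Z : {group gT}.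

Lemma maximal_adjoin M H x :
  maximal M H -> x \in H -> x \notin M -> M <*> <[x]> = H.
Proof.
case/maxgroupP=> /andP[sMH _] maxM xH xM.
have sJH : M <*> <[x]> \subset H by rewrite join_subG sMH cycle_subG.
apply/eqP; rewrite eqEsubset sJH /=; apply: contraR xM => nHJ.
rewrite -(maxM _ _ (joing_subl M <[x]>)); last by rewrite properE sJH.
by rewrite -cycle_subG joing_subr.
Qed.

(** Modulo [N] the hypotheses say that [H] and [x] centralize [A], and a centralizer is a
    subgroup. *)
Lemma commg_adjoin_sub N H x (A : {set gT}) :
  H \subset 'N(N) -> x \in 'N(N) -> A \subset 'N(N) ->
  [~: H, A] \subset N -> [~: [set x], A] \subset N ->
  [~: H <*> <[x]>, A] \subset N.
Proof.
move=> nH nx nA; have nxs : [set x] \subset 'N(N) by rewrite sub1set.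
rewrite -!quotient_cents2 // ?join_subG ?nH ?cycle_subG //.
rewrite quotientY ?cycle_subG // join_subG => -> /=.
by rewrite quotient_gen // gen_subG.
Qed.

(** The centralizer lies strictly between [Z] and [M], so its quotient by the central subgroup [Z]
    has order [p] and is cyclic. *)
Lemma centralizer_index_p2 (p : nat) M Z :
  prime p -> Z \subset 'Z(M) -> #|M : Z| = (p ^ 2)%N -> ~~ abelian M ->
  p.-group M ->
  forall a, a \in M :\: Z -> abelian 'C_M[a] /\ #|'C_M[a]| = (p * #|Z|)%N.
Proof.
move=> p_pr sZC iZ nabM pM a /setDP[aM aZ].
have sZM : Z \subset M := subset_trans sZC (center_sub M).
have between H : Z \proper H -> H \proper M -> #|H : Z| = p.
  move=> /[dup] /proper_sub sZH ltZH /[dup] /proper_sub sHM ltHM.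
  have := properG_ltn_log (pgroupS sHM pM) ltZH.
  have := properG_ltn_log pM ltHM.
  have [k iH] := p_natP (pnat_dvd (dvdn_indexg H Z) (pgroupS sHM pM)).
  have logH : logn p #|H| = (logn p #|Z| + k)%N.
    by rewrite -(Lagrange sZH) iH lognM ?cardG_gt0 ?expn_gt0 ?prime_gt0 // pfactorK.
  have -> : logn p #|M| = (logn p #|Z| + 2)%N.
    by rewrite -(Lagrange sZM) iZ lognM ?cardG_gt0 ?expn_gt0 ?prime_gt0 // pfactorK.
  rewrite logH ltn_add2l -[X in (X < _ + k)%N]addn0 ltn_add2l iH.
  by case: k {logH iH} => [|[|]].
have cyc H : Z \proper H -> H \proper M -> cyclic (H / Z).
  move=> ltZH ltHM; apply: prime_cyclic.
  rewrite card_quotient ?between //.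
  exact: subset_trans (proper_sub ltHM) (normal_norm (sub_center_normal sZC)).
have aC : a \in 'C_M[a] by rewrite inE aM cent1id.
have ltZC : Z \proper 'C_M[a].
  apply/properP; split; last by exists a.
  rewrite subsetI sZM sub_cent1; apply: subsetP aM.
  by rewrite centsC; apply: subset_trans sZC (subsetIr _ _).
(* Otherwise [a] is central, ['Z(M)] is strictly larger than [Z], and [M / 'Z(M)] is cyclic, which
   makes [M] abelian. *)
have ltCM : 'C_M[a] \proper M.
  rewrite properE subsetIl /=; apply: contra nabM; rewrite subsetI subxx => sMC.
  have aZM : a \in 'Z(M) by rewrite inE aM -sub_cent1.
  have ltZZ : Z \proper 'Z(M) by apply/properP; split=> //; exists a.
  have [eqZ|ltZM] := eqVproper (center_sub M); first by rewrite -eqZ center_abelian.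
  apply/cyclic_center_factor_abelian/prime_cyclic; rewrite card_quotient ?gFnorm //.
  have := Lagrange_index (center_sub M) sZC; rewrite iZ between // => /eqP.
  by rewrite expnS expn1 eqn_pmul2r ?prime_gt0 // => /eqP ->.
split; last by rewrite -(Lagrange (proper_sub ltZC)) between // mulnC.
apply: cyclic_factor_abelian (cyc _ ltZC ltCM).
rewrite subsetI proper_sub //=; apply: subset_trans sZC _.
by apply: subset_trans (subsetIr _ _) (centS (subsetIl _ _)).
Qed.
End GroupFacts.

(** * Lower central series, center and P_1 of a group of maximal class *)

Section MaximalClass.
Local Open Scope group_scope.
Variables (gT : finGroupType) (G : {group gT}) (p m : nat).
Hypothesis mcG : maximal_class p G m.
Let p_pr : prime p. Proof. by case: mcG. Qed.
Let oG : #|G| = (p ^ m)%N. Proof. by case: mcG. Qed.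
Let m4 : (4 <= m)%N. Proof. by case: mcG. Qed.
Let clG : nil_class G = m.-1. Proof. by case: mcG. Qed.

Lemma maximal_class_pgroup : p.-group G.
Proof. by rewrite /pgroup oG pnatX pnat_id. Qed.
Let pG := maximal_class_pgroup.
Let nilG := pgroup_nil pG.

Lemma maximal_class_nonabelian : ~~ abelian G.
Proof. by rewrite -nil_class1 clG; lia. Qed.

Lemma maximal_class_lcn1 : 'L_m(G) = 1.
Proof.
have -> : m = m.-1.+1 by lia.
by apply/(lcn_nil_classP _ nilG); rewrite clG.
Qed.

Lemma maximal_class_lcn_proper i : (0 < i < m)%N -> 'L_i.+1(G) \proper 'L_i(G).
Proof.
case: i => // i lt_im; rewrite lcnSn.
apply: (nil_comm_properl nilG); rewrite ?lcn_sub ?subsetI ?subxx ?lcn_norm //.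
by apply/eqP=> /(lcn_nil_classP _ nilG); rewrite clG; lia.
Qed.

(** The series decreases strictly: counting up from the trivial term ['L_m(G)] bounds the orders
    below, and counting down from ['L_2(G)] bounds them above. *)
Lemma card_maximal_class_lcn i : (2 <= i <= m)%N -> #|'L_i(G)| = (p ^ (m - i))%N.
Proof.
have pL k : p.-group 'L_k(G) := pgroupS (lcn_sub k G) pG.
have step k : (0 < k < m)%N ->
    (logn p #|'L_k.+1(G)| < logn p #|'L_k(G)|)%N.
  by move=> lt_km; apply: (properG_ltn_log (pL k)); apply: maximal_class_lcn_proper.
have lower k : (k < m)%N -> (k <= logn p #|'L_(m - k)(G)|)%N.
  elim: k => // k IHk lt_km; apply: leq_ltn_trans (IHk _) _; first lia.
  have -> : (m - k = (m - k.+1).+1)%N by lia.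
  by apply: step; lia.
(* If the derived subgroup had index [p], the abelianization would be cyclic, and hence so would the
   nilpotent group [G]. *)
have L2 : (logn p #|'L_2(G)| <= m - 2)%N.
  have lt2 : (logn p #|'L_2(G)| < m)%N.
    have := step 1%N; rewrite lcn1 oG pfactorK //; apply; lia.
  rewrite leqNgt; apply/negP=> ge2; case/negP: maximal_class_nonabelian.
  apply/cyclic_abelian/(cyclic_nilpotent_quo_der1_cyclic nilG)/prime_cyclic.
  rewrite -lcn2 card_quotient ?lcn_norm //.
  have := Lagrange (lcn_sub 2 G); rewrite oG (card_pgroup (pL 2)) /=.
  have -> : (logn p #|'L_2(G)| = m.-1)%N by lia.
  have -> : (p ^ m = p ^ m.-1 * p)%N by rewrite -expnSr prednK //; lia.
  by move=> /eqP; rewrite eqn_pmul2l ?expn_gt0 ?prime_gt0 // => /eqP ->.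
have upper k : (k.+2 <= m)%N -> (logn p #|'L_k.+2(G)| <= m - k.+2)%N.
  elim: k => // k IHk le_km; have /IHk : (k.+2 <= m)%N by lia.
  by have := step k.+2; lia.
case/andP=> i2 im; rewrite (card_pgroup (pL i)); congr expn; apply/eqP.
rewrite eqn_leq; case: i i2 im => [|[|i]] // _ im; rewrite upper //.
have := lower (m - i.+2)%N; rewrite subKn //; apply; lia.
Qed.

(** The quotient by the center has class [m - 2], at least 2, while a group of order p^k has class
    at most max(1, k-1); a center of order above [p] leaves too small a k. *)
Lemma card_maximal_class_center : #|'Z(G)| = p.
Proof.
have pZ : p.-group 'Z(G) := pgroupS (center_sub G) pG.
have z0 : (0 < logn p #|'Z(G)|)%N.
  rewrite lt0n; apply/eqP=> z0; case/negP: maximal_class_nonabelian.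
  have: 'Z(G) == 1 by rewrite trivg_card1 (card_pgroup pZ) z0.
  by rewrite (center_nil_eq1 nilG) => /eqP ->; apply: abelian1.
have oGZ : logn p #|G / 'Z(G)| = (m - logn p #|'Z(G)|)%N.
  rewrite card_quotient ?gFnorm // -divgS ?center_sub //.
  by rewrite logn_div ?cardSg ?center_sub // oG pfactorK.
have := nil_class_pgroup (quotient_pgroup 'Z(G) pG).
rewrite nil_class_quotient_center // clG oGZ => cl.
have z1 : logn p #|'Z(G)| = 1%N.
  by move: z0 cl; move: (logn p _) => z; rewrite /maxn; case: ifP; lia.
by rewrite (card_pgroup pZ) z1 expn1.
Qed.

Lemma index_maximal_class_lcn i : (2 <= i < m)%N -> #|'L_i(G) : 'L_i.+1(G)| = p.
Proof.
move=> i_m; rewrite -divgS ?lcn_subS // !card_maximal_class_lcn; try lia.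
rewrite (_ : m - i = (m - i.+1).+1)%N ?expnSr; last lia.
by rewrite mulKn // expn_gt0 prime_gt0.
Qed.

Lemma maximal_class_lcn_adjoin i x : (2 <= i < m)%N ->
  x \in 'L_i(G) -> x \notin 'L_i.+1(G) -> 'L_i.+1(G) <*> <[x]> = 'L_i(G).
Proof.
move=> i_m xi xSi.
have maxL : maximal 'L_i.+1(G) 'L_i(G).
  by apply: p_index_maximal; rewrite ?lcn_subS ?index_maximal_class_lcn.
exact: maximal_adjoin maxL xi xSi.
Qed.

Lemma sub_Pser1 (A : {set gT}) :
  A \subset G -> (A \subset Pser G m 1) = ([~: A, 'L_2(G)] \subset 'L_4(G)).
Proof.
move=> sAG; rewrite gen_subG; apply/subsetP/subsetP => [sAP c /imset2P[a b aA bL ->]|sAL a aA].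
  by have := sAP a aA; rewrite inE => /andP[_ /forall_inP/(_ b bL)].
rewrite inE (subsetP sAG) //=; apply/forall_inP=> b bL.
by apply: sAL; apply: imset2_f.
Qed.

(** With [s] generating ['L_2(G)] modulo ['L_3(G)], bilinearity modulo ['L_4(G)] leaves commutators
    involving ['L_3(G)], which fall in ['L_4(G)], and the trivial commutator of [s] with itself. *)
Lemma lcn2_sub_Pser1 : 'L_2(G) \subset Pser G m 1.
Proof.
rewrite sub_Pser1 ?lcn_sub //.
have [s sL sL3] : exists2 s, s \in 'L_2(G) & s \notin 'L_3(G).
  by have /properP[] := maximal_class_lcn_proper (ltnW m4 : 0 < 2 < m)%N.
have adj := maximal_class_lcn_adjoin _ sL sL3.
have nL k : 'L_k(G) \subset 'N('L_4(G)) := subset_trans (lcn_sub k G) (lcn_norm 4 G).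
have cL3 : [~: 'L_3(G), 'L_2(G)] \subset 'L_4(G).
  by rewrite (lcnSn 2); apply: commgS; apply: lcn_sub.
rewrite -{1}adj; last lia.
apply: commg_adjoin_sub; rewrite ?nL ?(subsetP (nL 2)) //.
rewrite -adj; last lia.
rewrite commGC; apply: commg_adjoin_sub; rewrite ?nL ?(subsetP (nL 2)) //.
- by rewrite sub1set (subsetP (nL 2)).
- by apply: subset_trans cL3; apply: commgS; rewrite sub1set.
suff -> : [~: [set s], [set s]] = 1 by apply: sub1G.
by apply/commG1P; rewrite cent_set1 sub1set cent1id.
Qed.

(* If s generates 'L_2(G) modulo 'L_3(G), then P_1 is the preimage of the
   centralizer of s in G / 'L_4(G), whose index is at most |'L_3(G) / 'L_4(G)| = p
   because every conjugate of s lies in s 'L_3(G). *)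
Lemma maximal_class_Pser1 : exists2 M : {group gT},
  Pser G m 1 = M & maximal M G.
Proof.
have [s sL sL3] : exists2 s, s \in 'L_2(G) & s \notin 'L_3(G).
  by have /properP[] := maximal_class_lcn_proper (ltnW m4 : 0 < 2 < m)%N.
have adj : 'L_3(G) <*> <[s]> = 'L_2(G) by apply: maximal_class_lcn_adjoin => //; lia.
have sG : s \in G := subsetP (lcn_sub 2 G) s sL.
have nL (A : {set gT}) : A \subset G -> A \subset 'N('L_4(G)).
  by move=> sAG; apply: subset_trans sAG (lcn_norm 4 G).
have cL3 (A : {set gT}) : A \subset G -> [~: 'L_3(G), A] \subset 'L_4(G).
  by move=> sAG; rewrite (lcnSn 2); apply: commgS.
have in_L4 (A : {set gT}) : A \subset G ->
    ([~: A, 'L_2(G)] \subset 'L_4(G)) = ([~: A, [set s]] \subset 'L_4(G)).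
  move=> sAG; apply/idP/idP; first by apply: subset_trans; apply: commgS; rewrite sub1set.
  move=> As; rewrite -adj commGC; apply: commg_adjoin_sub; rewrite ?nL ?lcn_sub ?cL3 //.
    by rewrite (subsetP (lcn_norm 4 G)).
  by rewrite commGC.
pose K := 'C_(G / 'L_4(G))[coset 'L_4(G) s].
have sKG : coset 'L_4(G) @*^-1 K \subset G.
  apply: subset_trans (morphpreS _ (subsetIl _ _)) _.
  by rewrite (quotientGK (lcn_normal 4 G)).
have PK : Pser G m 1 = coset 'L_4(G) @*^-1 K.
  apply/setP=> g; have [gG|nGg] := boolP (g \in G); last first.
    by rewrite inE (negPf nGg); apply/esym/(contraNF _ nGg)/(subsetP sKG).
  have sgG : [set g] \subset G by rewrite sub1set.
  rewrite -sub1set sub_Pser1 // in_L4 // -[RHS]sub1set.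
  have sgS : [set s] \subset G by rewrite sub1set.
  rewrite -quotient_cents2 ?nL // -sub_quotient_pre ?nL //.
  rewrite !quotient_set1 ?(subsetP (lcn_norm 4 G)) //.
  by rewrite cent_set1 !sub1set in_setI mem_quotient.
exists (coset 'L_4(G) @*^-1 K)%G => //.
suff: maximal K (G / 'L_4(G)).
  by rewrite -cosetpre_maximal (quotientGK (lcn_normal 4 G)).
have pQ : p.-group (G / 'L_4(G)) := quotient_pgroup _ pG.
have iK : (#|G / 'L_4(G) : K| <= p)%N.
  rewrite /K index_cent1.
  have <- : #|coset 'L_4(G) s *: ('L_3(G) / 'L_4(G))| = p.
    rewrite card_lcoset card_quotient ?nL ?lcn_sub // index_maximal_class_lcn //.
  apply: subset_leq_card; apply/subsetP=> _ /imsetP[_ /morphimP[g nLg gG ->] ->].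
  have nLs := subsetP (lcn_norm 4 G) s sG.
  rewrite mem_lcoset -morphV // -morphJ // -morphM ?groupV ?groupJ //.
  have sg3 : [~ s, g] \in 'L_3(G) by rewrite (lcnSn 1) mem_commg.
  by apply: mem_quotient; rewrite -commgEl.
(* Index 1 would mean that [G] centralizes [s], hence ['L_2(G)], modulo ['L_4(G)], and ['L_3(G)]
   would equal ['L_4(G)]. *)
have iK1 : (1 < #|G / 'L_4(G) : K|)%N.
  rewrite indexg_gt1; apply/negP; rewrite subsetI subxx /= => sGC.
  have : [~: G, [set s]] \subset 'L_4(G).
    rewrite -quotient_cents2 ?nL ?sub1set //.
    by rewrite quotient_set1 ?(subsetP (lcn_norm 4 G)) // cent_set1.
  rewrite -in_L4 // commGC -lcnSn => sL34.
  have := maximal_class_lcn_proper (m4 : 0 < 3 < m)%N.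
  by rewrite properE sL34 andbF.
apply: p_index_maximal; first exact: subsetIl.
have [k oK] := p_natP (pnat_dvd (dvdn_indexg _ _) pQ : p.-nat #|G / 'L_4(G) : K|).
rewrite oK in iK iK1 *; case: k {oK} iK iK1 => [|[|k]]; rewrite ?expn1 ?expn0 //.
move=> le_p; have : (p ^ k.+2 <= p ^ 1)%N by rewrite expn1.
by rewrite (leq_exp2l _ _ (prime_gt1 p_pr)).
Qed.

(** * Centralizers of elements outside P_1 when the degree of commutativity is positive *)

Section PositiveDegree.
Variable M : {group gT}.
Hypotheses (defM : Pser G m 1 = M) (maxM : maximal M G).
Hypothesis degG : forall i j : nat, (0 < i)%N -> (0 < j)%N ->
  [~: Pser G m i, Pser G m j] \subset Pser G m (i + j + 1).

Let sMG : M \subset G. Proof. exact: proper_sub (maxgroupp maxM). Qed.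

Lemma card_maximal_class_maximal : #|M| = (p ^ m.-1)%N.
Proof.
apply/eqP; rewrite -(eqn_pmul2r (prime_gt0 p_pr)) -expnSr prednK; last by lia.
by rewrite -oG -(Lagrange sMG) (p_maximal_index pG maxM).
Qed.

Lemma Pser_lcn i : (2 <= i)%N -> Pser G m i = 'L_i(G).
Proof.
case: i => [|[|i]] // _; rewrite /Pser /=; case: ifPn => //; rewrite -leqNgt => le_mi.
by apply/esym/trivgP; rewrite -maximal_class_lcn1 lcn_sub_leq.
Qed.

(* If y commutes with x and lies in P_i but not in P_{i+1}, then y is central
   modulo P_{i+2}: it commutes with x exactly and with P_1 by positivity of the
   degree. Since y generates P_i modulo P_{i+1}, this makes the series stop. *)
Lemma maximal_class_centralizer_out x :
  x \in G :\: M -> 'C_M[x] = 'Z(G).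
Proof.
case/setDP=> xG xM; have adjM := maximal_adjoin maxM xG xM.
have sL2M : 'L_2(G) \subset M by rewrite -defM lcn2_sub_Pser1.
have deg i : (1 <= i)%N -> [~: M, Pser G m i] \subset 'L_i.+2(G).
  move=> i0; have := degG (isT : 0 < 1)%N i0.
  by rewrite defM addn1 add1n (Pser_lcn (i := i.+2)).
have nL (A : {set gT}) k : A \subset G -> A \subset 'N('L_k(G)).
  by move=> sAG; apply: subset_trans sAG (lcn_norm k G).
have sg1 z : z \in G -> [set z] \subset G by rewrite sub1set.
have genG (N : {group gT}) (A : {set gT}) : G \subset 'N(N) -> A \subset 'N(N) ->
    [~: M, A] \subset N -> [~: [set x], A] \subset N -> [~: G, A] \subset N.
  move=> nNG nNA cMA cxA; rewrite -adjM; apply: commg_adjoin_sub => //.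
    exact: subset_trans sMG nNG.
  exact: subsetP nNG x xG.
have commxx z : commute x z -> [~: [set x], [set z]] = 1.
  by move=> cxz; apply/commG1P; rewrite cent_set1 sub1set; apply/cent1P.
have commG k z : z \in M -> commute x z -> [~: [set z], M] \subset 'L_k(G) ->
    [~: [set z], G] \subset 'L_k(G).
  move=> zM cxz czM; have zG := subsetP sMG z zM.
  rewrite commGC; apply: (genG); rewrite ?commxx ?sub1G ?lcn_norm //.
    by apply: nL; apply: sg1.
  by rewrite commGC.
(* The first layer is separate because [M] is not a term of the lower central series. A [y] outside
   ['L_2(G)] generates [M] modulo it; then [M], and after adjoining [x] all of [G], is central
   modulo ['L_3(G)], so the series stops at ['L_2(G)]. *)
have base y : y \in M -> commute x y -> y \in 'L_2(G).
  move=> yM cxy; have yG := subsetP sMG y yM; apply: contraT => yL.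
  have maxL2 : maximal 'L_2(G) M.
    apply: p_index_maximal => //.
    have := Lagrange sL2M; rewrite card_maximal_class_maximal.
    rewrite (card_maximal_class_lcn (i := 2)); last exact: leq_trans m4.
    rewrite (_ : m.-1 = (m - 2).+1); last first.
      by case: (m) m4 => [|[|k]] // _; rewrite !subSS subn0.
    by rewrite expnSr => /eqP; rewrite eqn_pmul2l ?expn_gt0 ?prime_gt0 // => /eqP ->.
  have sYG : [~: [set y], G] \subset 'L_3(G).
    apply: commG => //; have := deg 1%N isT; rewrite defM.
    by apply/subset_trans/commSg; rewrite sub1set.
  have sMG3 : [~: M, G] \subset 'L_3(G).
    rewrite -(maximal_adjoin maxL2 yM yL).
    apply: commg_adjoin_sub; rewrite ?nL ?lcn_sub ?(subsetP (nL G _ _)) //.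
  have sGG : [~: G, G] \subset 'L_3(G).
    apply: (genG); rewrite ?lcn_norm // commGC.
    apply: (genG); rewrite ?lcn_norm ?commxx ?sub1G //; first by apply: nL; apply: sg1.
    by apply: subset_trans (commgS _ _) sMG3; apply: sg1.
  have := maximal_class_lcn_proper (ltnW m4 : 0 < 2 < m)%N.
  by rewrite properE (lcnSn 0) lcn1 sGG andbF.
have step y k : y \in M -> commute x y -> (k.+2 < m)%N -> y \in 'L_k.+2(G).
  move=> yM cxy; elim: k => [|k IHk] lt_km; first exact: base.
  have yL : y \in 'L_k.+2(G) by exact: IHk (ltnW _).
  apply: contraT => yL3.
  have sYG : [~: [set y], G] \subset 'L_k.+4(G).
    apply: commG => //; rewrite commGC.
    have := deg k.+2 isT; rewrite Pser_lcn //.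
    by apply/subset_trans/commgS; rewrite sub1set.
  have sLG : 'L_k.+3(G) \subset 'L_k.+4(G).
    rewrite lcnSn -(maximal_class_lcn_adjoin _ yL yL3); last exact: ltnW.
    apply: commg_adjoin_sub; rewrite ?nL ?lcn_sub ?(subsetP (nL G _ _)) //.
      exact: subsetP sMG y yM.
  have := maximal_class_lcn_proper (lt_km : 0 < k.+3 < m)%N.
  by rewrite properE sLG andbF.
have sZM : 'Z(G) \subset M.
  rewrite -defM sub_Pser1 ?center_sub //; have -> : [~: 'Z(G), 'L_2(G)] = 1.
    by apply/commG1P; apply: subset_trans (subsetIr _ _) (centS (lcn_sub 2 G)).
  exact: sub1G.
apply/eqP; rewrite eqEsubset; apply/andP; split; last first.
  rewrite subsetI sZM sub_cent1; apply: subsetP xG.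
  by rewrite centsC subsetIr.
apply/subsetP=> y /setIP[yM /cent1P cxy]; rewrite inE (subsetP sMG) //=.
(* [m - 3] is the last index [step] allows; it reaches the last nontrivial term, which is central
   since ['L_m(G)] is trivial. *)
have yL : y \in 'L_m.-1(G).
  have := step y (m - 3); case: (m) m4 => [|[|[|k]]] // _; rewrite !subSS subn0.
  exact.
apply: subsetP yL; apply/commG1P/trivgP; rewrite -maximal_class_lcn1.
have {2}-> : m = m.-1.+1 by rewrite prednK // (leq_trans _ m4).
exact: lcnSnS.
Qed.
End PositiveDegree.
End MaximalClass.

(** * Coefficients of the rational generating functions *)

Section Series.
Local Open Scope ring_scope.

Lemma smul_monomial_0 (c : rat) (f : series) : smul (sscale c sX) f 0%N = 0.
Proof. by rewrite /smul /sscale /sX big_ord1 mulr0 mul0r. Qed.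

Lemma smul_monomial_S (c : rat) (f : series) n :
  smul (sscale c sX) f n.+1 = c * f n.
Proof.
rewrite /smul /sscale /sX !big_ord_recl big1 => [|i _] /=; last by rewrite mulr0 mul0r.
by rewrite mulr0 mul0r mulr1 add0r addr0 subn1.
Qed.

Lemma smul_sinv_lin_0 (a : rat) (f : series) : smul (sinv_lin a) f 0%N = f 0%N.
Proof. by rewrite /smul /sinv_lin big_ord1 expr0 mul1r. Qed.

(** This is (1 - a t) F = f read coefficientwise for F = f / (1 - a t); the closed forms below are
    proved by induction along it. *)
Lemma smul_sinv_lin_S (a : rat) (f : series) n :
  smul (sinv_lin a) f n.+1 = a * smul (sinv_lin a) f n + f n.+1.
Proof.
rewrite /smul /sinv_lin big_ord_recl expr0 mul1r addrC mulr_sumr; congr (_ + _).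
by apply: eq_bigr => i _; rewrite exprS mulrA.
Qed.

Lemma smul_sinv_lin2 (a b : rat) n :
  a != b -> smul (sinv_lin a) (sinv_lin b) n = (a ^+ n.+1 - b ^+ n.+1) / (a - b).
Proof.
rewrite -subr_eq0 => ab; elim: n => [|n IHn].
  by rewrite smul_sinv_lin_0 /sinv_lin expr0 !expr1 divff.
by rewrite smul_sinv_lin_S IHn /sinv_lin !exprS; field.
Qed.

Lemma smul_monomial_slin_S (c a : rat) (f : series) n :
  smul (smul (sscale c sX) (slin a)) f n.+1
    = c * (f n - (if n is k.+1 then a * f k else 0)).
Proof.
have slin0 : slin a 0%N = 1 by rewrite /slin /sadd /sscale /= mulr0 addr0.
have slin1 : slin a 1%N = - a by rewrite /slin /sadd /sscale /= mulr1 add0r.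
have slinS k : slin a k.+2 = 0 by rewrite /slin /sadd /sscale /= mulr0 addr0.
rewrite {1}/smul big_ord_recl smul_monomial_0 mul0r add0r big_ord_recl.
rewrite smul_monomial_S slin0 mulr1 /bump /= subSS subn0 mulrBr; congr (_ + _).
case: n => [|n]; first by rewrite big_ord0 mulr0 oppr0.
rewrite big_ord_recl big1 ?addr0 => [|i _]; last first.
  by rewrite smul_monomial_S slinS mulr0 mul0r.
by rewrite smul_monomial_S slin1 /bump /= !subSS subn0; ring.
Qed.

Lemma smul_monomial_slin_0 (c a : rat) (f : series) :
  smul (smul (sscale c sX) (slin a)) f 0%N = 0.
Proof. by rewrite {1}/smul big_ord1 smul_monomial_0 mul0r. Qed.

(** Partial fractions, with [x] standing for p^(m-2). A free [x] turns the induction step into an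
    identity of rational functions for [field]. *)
Lemma abelian_maximal_series (q x : rat) n :
  q != 0 -> q != 1 -> x != 1 ->
  smul (sinv_lin q)
    (sadd (sconst 1)
      (sadd (smul (sscale (x - 1) sX) (sinv_lin (x * q)))
            (smul (sscale (q ^+ 2 - q) sX) (sinv_lin (q ^+ 2))))) n
  = (x * q) ^+ n / q + q ^+ (2 * n) - q ^+ n / q.
Proof.
move=> q0 q1 x1; elim: n => [|n IHn].
  rewrite smul_sinv_lin_0 /sadd !smul_monomial_0 /sconst /= muln0 !expr0.
  by field.
rewrite smul_sinv_lin_S IHn /sadd !smul_monomial_S /sinv_lin /sconst /=.
by rewrite mulnS exprD -!exprM !exprS; field.
Qed.

(** Here [x] stands for p^(m-5), so that p^(m-4), p^(m-3) and p^(m-2) are [x] times powers of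
    [q]. *)
Lemma central_P3_series (q x : rat) n :
  q != 0 -> q != 1 -> x != 0 -> 
  smul (sinv_lin q)
       (sadd (sconst 1)
         (sadd (smul (smul (sscale (x * q - 1) sX) (slin (x * q)))
                     (smul (sinv_lin (x * q ^+ 3)) (sinv_lin (x * q ^+ 2))))
         (sadd (smul (sscale (x * q ^+ 2 - x) sX)
                     (sinv_lin (x * q ^+ 3)))
               (smul (sscale (q ^+ 2 - q) sX) (sinv_lin (q ^+ 2)))))) n
  = (q + 1) * (x * q ^+ 3) ^+ n / q ^+ 2 - (x * q ^+ 2) ^+ n / q ^+ 2
    + q ^+ (2 * n) - q ^+ n / q.
Proof.
move=> q0 q1 x0.
have ab : x * q ^+ 3 != x * q ^+ 2.
  rewrite -subr_eq0 (_ : _ - _ = x * q ^+ 2 * (q - 1)); last by ring.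
  by rewrite !mulf_neq0 ?expf_neq0 ?subr_eq0.
(* The numerator t (1 - x q t) reaches two indices back, so coefficients 0 and 1 are computed
   directly and the uniform recursion starts at 2. *)
case: n => [|n].
  rewrite smul_sinv_lin_0 /sadd smul_monomial_slin_0 !smul_monomial_0 /sconst /=.
  by rewrite muln0 !expr0; field.
elim: n => [|n IHn]; rewrite smul_sinv_lin_S.
  rewrite smul_sinv_lin_0 /sadd smul_monomial_slin_0 !smul_monomial_0.
  rewrite smul_monomial_slin_S !smul_monomial_S smul_sinv_lin_0.
  by rewrite /sinv_lin /sconst /= !expr0 expr1 muln1; field.
rewrite IHn /sadd smul_monomial_slin_S !smul_monomial_S !smul_sinv_lin2 //.
rewrite /sinv_lin /sconst /= !(mulnC 2) !(exprM q) !(exprAC q 2).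
by rewrite !(exprS _ n.+1) !(exprS _ n); field; rewrite q0 subr_eq0 ab.
Qed.
End Series.

(** * From the group structure to closed formulas for the counts *)

Section Counting.
Local Open Scope group_scope.
Variable gT : finGroupType.
Implicit Types G M Z : {group gT}.

(** An element of [M] commuting with [x] centralizes both [M] and [x], which generate [G].
    Conversely the center lies in [M], since adjoining an outside central element to [M] would give
    an abelian [G]. *)
Lemma centralizer_out_abelian_maximal G M :
  ~~ abelian G -> maximal M G -> abelian M ->
  forall x, x \in G :\: M -> 'C_M[x] = 'Z(G).
Proof.
move=> nabG maxM cMM x /setDP[xG xM].
have sMG := proper_sub (maxgroupp maxM).
have adjM z : z \in G -> z \notin M -> M <*> <[z]> = G := maximal_adjoin maxM.
have sZM : 'Z(G) \subset M.
  apply/subsetP=> z /setIP[zG zC]; apply: contraR nabG => zM.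
  rewrite -(adjM z) // abelianY cMM cycle_abelian cycle_subG /=.
  exact: subsetP (centS sMG) z zC.
apply/eqP; rewrite eqEsubset; apply/andP; split; last first.
  by rewrite subsetI sZM sub_cent1; apply: subsetP xG; rewrite centsC subsetIr.
apply/subsetP=> y /setIP[yM cxy]; rewrite inE (subsetP sMG) //=.
rewrite -sub_cent1 -(adjM x) // join_subG sub_cent1 (subsetP cMM) //=.
by rewrite cycle_subG cent1C.
Qed.

Local Open Scope ring_scope.

Lemma beta_maximal_class G M (p m n : nat) :
  maximal_class p G m.+2 -> maximal M G ->
  (forall x, x \in G :\: M -> 'C_M[x]%g = 'Z(G)%g) ->
  let q : rat := p%:R in
  (beta G n)%:R * (q ^+ m * q ^+ 2)
    = (#|commuting_tuples M n.+1|)%:R + q ^+ m * (q ^+ (2 * n.+1) - q ^+ n.+1).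
Proof.
move=> mcG maxM regM q; have [p_pr oG _ _] := mcG.
have := card_commuting_tuples_diff n.+1 p_pr oG maxM (card_maximal_class_center mcG) regM.
move/(congr1 (fun k : nat => k%:R : rat)).
rewrite card_commuting_tuples_beta oG !natrD natrM !natrX -/q => eq_c.
by rewrite mulrBr -!exprD addn2 addrA -eq_c addrK.
Qed.

(** Solves c_(n+1) = p^k c_n + (p^(k+2) - p^k) p^((k+1)n), c_0 = 1, where the centralizers outside
    [Z] are abelian of order p^(k+1). *)
Lemma card_commuting_tuples_index_p2 M Z (p k n : nat) :
  prime p -> #|M| = (p ^ k.+2)%N -> Z \subset 'Z(M)%g -> #|Z| = (p ^ k)%N ->
  ~~ abelian M ->
  let q : rat := p%:R in
  (#|commuting_tuples M n|)%:R
    = (q + 1) * (q ^+ k * q) ^+ n - q * (q ^+ k) ^+ n.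
Proof.
move=> p_pr oM sZC oZ nabM q.
have pM : p.-group M by rewrite /pgroup oM pnatX pnat_id.
have sZM : Z \subset M := subset_trans sZC (center_sub M).
have iZ : #|M : Z|%g = (p ^ 2)%N.
  apply/eqP; rewrite -(eqn_pmul2l (cardG_gt0 Z)) Lagrange // oM oZ -expnD.
  by rewrite addn2.
have abC := centralizer_index_p2 p_pr sZC iZ nabM pM.
elim: n => [|n IHn]; first by rewrite card_commuting_tuples0 !expr0; ring.
have := card_commuting_tuples_center_out n sZC abC.
have le_ZM : (p ^ k <= p ^ k.+2)%N by rewrite leq_pexp2l ?prime_gt0 // ltnW.
rewrite oM oZ => /(congr1 (fun k : nat => k%:R : rat)) ->.
rewrite natrD !natrM natrB // !natrX natrM !natrX IHn -/q.
by rewrite !(exprS q) !(exprS _ n) (mulrC q (q ^+ k)); ring.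
Qed.
End Counting.

Local Open Scope ring_scope.

Theorem theorem8p5 (gT : finGroupType) (G : {group gT}) (p m : nat) :
  maximal_class p G m -> pos_deg_comm G m ->
  let q : rat := p%:R in
  (has_abelian_maximal G ->
     Bser G =
     smul (sinv_lin q)
       (sadd (sconst 1)
         (sadd (smul (sscale (q ^+ (m - 2) - 1) sX) (sinv_lin (q ^+ (m - 1))))
               (smul (sscale (q ^+ 2 - q) sX) (sinv_lin (q ^+ 2)))))) /\
  ([~: Pser G m 1, Pser G m 3]%g = 1%g -> ~ has_abelian_maximal G ->
     Bser G =
     smul (sinv_lin q)
       (sadd (sconst 1)
         (sadd (smul (smul (sscale (q ^+ (m - 4) - 1) sX) (slin (q ^+ (m - 4))))
                     (smul (sinv_lin (q ^+ (m - 2))) (sinv_lin (q ^+ (m - 3)))))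
         (sadd (smul (sscale (q ^+ (m - 3) - q ^ (m%:Z - 5)) sX)
                     (sinv_lin (q ^+ (m - 2))))
               (smul (sscale (q ^+ 2 - q) sX) (sinv_lin (q ^+ 2))))))).

Proof.
move=> mcG degG q; have [p_pr oG m4 _] := mcG.
have q0 : q != 0 by rewrite pnatr_eq0 -lt0n prime_gt0.
have q1 : q != 1 by rewrite pnatr_eq1; case: (p) p_pr => [|[|]].
split=> [[M [maxM cMM]]|cP13 nabG].
  case: m mcG m4 {degG} oG => [|[|m]] // mcG m4 oG; rewrite !subSS !subn0.
  have regM := centralizer_out_abelian_maximal (maximal_class_nonabelian mcG) maxM cMM.
  have x1 : q ^+ m != 1.
    rewrite -natrX pnatr_eq1; apply: contraTneq (prime_gt1 p_pr) => pm1.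
    rewrite -leqNgt -pm1.
    by have := leq_pexp2l (prime_gt0 p_pr) (ltnW (m4 : 1 < m)%N); rewrite expn1.
  have qm0 : q ^+ m != 0 by rewrite expf_neq0.
  apply: (@functional_extensionality nat rat) => n.
  rewrite (exprSr q m) abelian_maximal_series // /Bser.
  have := beta_maximal_class n mcG maxM regM; rewrite -/q /=.
  rewrite card_commuting_tuples_abelian // (card_maximal_class_maximal mcG maxM) /=.
  rewrite !natrX -/q (exprSr q m) => eq_b.
  (* The cancelled factor is the order of [G], which multiplies [beta] in [eq_b]. *)
  apply: (mulIf (mulf_neq0 qm0 (expf_neq0 2 q0))); rewrite eq_b.
  by rewrite !(mulnC 2) !exprM !(exprS _ n); field.
have [M defM maxM] := maximal_class_Pser1 mcG.
have nabM : ~~ abelian M by apply/negP=> cMM; apply: nabG; exists M.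
case: degG => [|degG]; first by rewrite defM (negPf nabM).
have PL := Pser_lcn mcG.
have oM := card_maximal_class_maximal mcG maxM.
have oL := card_maximal_class_lcn mcG.
have sLM i : (2 <= i)%N -> 'L_i(G)%g \subset M.
  by move=> i2; rewrite -defM; apply: subset_trans (lcn_sub_leq _ i2) (lcn2_sub_Pser1 mcG).
(* For [m] equal to 4, [P_1, P_2] lies in P_4 = 1, so ['L_2(G)] is central of index [p] in [M] and
   [M] is abelian. Hence the integer exponent m-5 is a natural number [k]. *)
have m5 : (4 < m)%N.
  rewrite ltn_neqAle m4 andbT; apply: contra nabM => /eqP m_4.
  have sLZ : 'L_2(G)%g \subset 'Z(M)%g.
    rewrite subsetI sLM //=; rewrite centsC; apply/commG1P/trivgP.
    have L4 : 'L_4(G)%g = 1%g by rewrite m_4 (maximal_class_lcn1 mcG).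
    by have := degG 1%N 2%N isT isT; rewrite defM !PL // L4.
  have iL : #|M : 'L_2(G)|%g = p.
    apply/eqP; rewrite -(eqn_pmul2l (cardG_gt0 'L_2(G))) Lagrange ?sLM // oM oL -m_4 //.
    by rewrite -expnSr.
  apply: cyclic_factor_abelian sLZ _; apply: prime_cyclic.
  by rewrite card_quotient ?iL // (subset_trans (proper_sub (maxgroupp maxM))) ?lcn_norm.
case: m mcG m4 m5 oG degG cP13 defM PL oM oL
  => [|[|[|[|[|k]]]]] // mcG m4 _ oG degG cP13 defM PL oM oL.
have regM := maximal_class_centralizer_out mcG defM maxM degG.
have sLZ : 'L_3(G)%g \subset 'Z(M)%g.
  rewrite subsetI sLM //= centsC; apply/commG1P.
  by rewrite -defM -(PL 3%N).
rewrite (_ : k.+4.+1%:Z - 5 = k%:Z); last by lia.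
have e1 : q ^+ k.+1 = q ^+ k * q by rewrite exprSr.
have e2 : q ^+ k.+2 = q ^+ k * q ^+ 2 by rewrite -exprD addn2.
have e3 : q ^+ k.+3 = q ^+ k * q ^+ 3 by rewrite -exprD addn3.
rewrite -exprnP !subSS !subn0 e1 e2 e3.
apply: (@functional_extensionality nat rat) => n.
rewrite central_P3_series ?expf_neq0 // /Bser.
have := beta_maximal_class n mcG maxM regM; rewrite -/q /=.
(* Now m = k+5: [M] has order p^(k+4) and the central subgroup ['L_3(G)] has order p^(k+2). *)
have -> := card_commuting_tuples_index_p2 n.+1 p_pr oM sLZ (oL 3%N isT) nabM.
rewrite -/q e2 e3 => eq_b.
have qk0 : q ^+ k != 0 by rewrite expf_neq0.
have x0 : q ^+ k * q ^+ 3 * q ^+ 2 != 0 by rewrite !mulf_neq0 ?expf_neq0.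
apply: (mulIf x0); rewrite eq_b.
by rewrite -(mulrA _ (q ^+ 2) q) -(exprSr q 2) !(mulnC 2) !exprM !(exprS _ n); field.
Qed.
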